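(* For every integer $n>3$, the product $$P_n=\prod_{k=1}^n (k^2+1)$$ is not a perfect square. *)

(* Defs.v *)
From mathcomp Require Import all_boot.

(* Main.v *)
Require Import Defs.
From mathcomp Require Import all_boot.
From mathcomp Require Import zify.
From mathcomp Require cyclic.

(* Suppose P_n is a square.  Modulo a power q of an odd prime, k^2 = -1 has at
   most two roots, which are opposite, so [1, n] contains at most
   floor(2n/q) + 1 of them.  Hence v_p(P_n) <= v_p((2n)!) + log_p(n^2+1) for p = 1
   mod 4, while v_p(P_n) = 0 for p = 3 mod 4; and no prime p > 2n divides P_n,
   since it would do so exactly once.  Multiplying over p <= 2n, and using
   primorial(n) <= 4^n, bounds P_n by the part of (2n)! made of primes 1 mod 4,
   up to a factor exponential in n.  Since P_n >= n!^2 >= (2n)!/4^n, the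
   complementary part of (2n)! is at most exponential in n.  But that part is at
   least the (2n/1000)-th power of its value for 1000!, which a computation
   shows to be too large.  For small n, one of the primes 17, 101, 8101 and
   160001, of the form k^2+1, divides P_n exactly once. *)

Local Notation P n := (\prod_(1 <= k < n.+1) (k ^ 2 + 1)).

Lemma sum_leq_nat (B L : nat) : L < B -> \sum_(1 <= j < B) (j <= L) = L.
Proof.
case: B => // B; rewrite ltnS => leLB.
rewrite (@big_cat_nat _ _ _ L.+1) //= [X in X + _]big_nat_cond.
rewrite (eq_bigr (fun=> 1)) => [|j /andP[/andP[_ lejL] _]]; last by rewrite -ltnS lejL.
rewrite -big_nat_cond sum_nat_const_nat muln1 subn1 /= big_nat_cond big1 ?addn0 //.
by move=> j /andP[/andP[ltLj _] _]; rewrite leqNgt ltLj.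
Qed.

Lemma logn_sum_dvd (p m B : nat) : prime p -> 0 < m -> m < B ->
  logn p m = \sum_(1 <= j < B) (p ^ j %| m).
Proof.
move=> p_pr m_gt0 ltmB.
under eq_bigr do rewrite pfactor_dvdn //.
rewrite sum_leq_nat //; apply: leq_ltn_trans ltmB.
have := dvdn_leq m_gt0 (pfactor_dvdnn p m).
by apply: leq_trans; rewrite ltnW // ltn_expl // prime_gt1.
Qed.

Lemma trunc_log_sum (p m B : nat) : 1 < p -> 0 < m -> m < B ->
  trunc_log p m = \sum_(1 <= j < B) (p ^ j <= m).
Proof.
move=> p_gt1 m_gt0 ltmB.
have E j : (p ^ j <= m) = (j <= trunc_log p m).
  apply/idP/idP => [|lej]; first exact: trunc_log_max.
  by apply: leq_trans (trunc_logP p_gt1 m_gt0); rewrite leq_exp2l.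
under eq_bigr do rewrite E.
rewrite sum_leq_nat //; apply: leq_ltn_trans ltmB.
by have := trunc_logP p_gt1 m_gt0; apply: leq_trans; rewrite ltnW // ltn_expl.
Qed.

Lemma logn_fact_sum (p n B : nat) : prime p -> n < B ->
  logn p n`! = \sum_(1 <= j < B) n %/ p ^ j.
Proof.
move=> p_pr ltnB; rewrite logn_fact // [RHS](@big_cat_nat _ _ _ n.+1) //=.
rewrite [X in _ = _ + X]big_nat_cond [X in _ = _ + X]big1 ?addn0 //.
move=> j /andP[/andP[ltnj _] _]; rewrite divn_small //.
by apply: ltn_trans ltnj _; rewrite ltn_expl ?prime_gt1.
Qed.

Lemma prodS_gt0 n : 0 < P n.
Proof. by rewrite prodn_cond_gt0 // => k _; rewrite addn1. Qed.

Lemma logn_prodS (p n : nat) :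
  logn p (P n) = \sum_(1 <= k < n.+1) logn p (k ^ 2 + 1).
Proof.
elim: n => [|n IHn]; first by rewrite !big_geq // logn1.
by rewrite big_nat_recr // [RHS]big_nat_recr //= lognM ?IHn ?prodS_gt0 ?addn1.
Qed.

Lemma dvdn_sqrS_pm (p j k l : nat) : prime p -> odd p -> k <= l ->
  p ^ j %| k ^ 2 + 1 -> p ^ j %| l ^ 2 + 1 ->
  (p ^ j %| l - k) || (p ^ j %| l + k).
Proof.
move=> p_pr p_odd lekl dk dl.
case: j => [|j] in dk dl *; first by rewrite dvd1n.
have d : p ^ j.+1 %| (l - k) * (l + k).
  by rewrite -subn_sqr -(subnDr 1) dvdn_sub.
have [dp|ndp] := boolP (p %| l - k); last first.
  by apply/orP; right; rewrite Gauss_dvdr // in d; rewrite coprimeXl // prime_coprime.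
apply/orP; left; rewrite Gauss_dvdl // in d; rewrite coprimeXl // prime_coprime //.
apply/negP => dp'.
have pk : p %| k ^ 2 + 1 by apply: dvdn_trans dk; rewrite expnS dvdn_mulr.
have : p %| (l + k) - (l - k) by apply: dvdn_sub.
have -> : (l + k) - (l - k) = 2 * k.
  by rewrite subnBA // -addnA addKn addnn mul2n.
rewrite Euclid_dvdM // => /orP[p2|pk'].
  by rewrite dvdn_prime2 // in p2; rewrite (eqP p2) in p_odd.
have : p %| 1 by rewrite -(dvdn_addr 1 (_ : p %| k ^ 2)) ?dvdn_exp.
by rewrite dvdn1 => /eqP p1; rewrite p1 in p_pr.
Qed.

(* The solutions [k <= n] of [q | k^2+1] are [+-a] modulo [q]: reflecting those
   congruent to [-a], they become elements of a single residue class in [0, 2n]. *)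
Lemma count_sqrS (p j n : nat) : prime p -> odd p ->
  \sum_(1 <= k < n.+1) (p ^ j %| k ^ 2 + 1) <= n.*2 %/ p ^ j + (p ^ j <= n ^ 2 + 1).
Proof.
move=> p_pr p_odd; set q := p ^ j.
have q_gt0 : 0 < q by rewrite expn_gt0 prime_gt0.
pose S := [set k : 'I_n.+1 | (0 < k) && (q %| k ^ 2 + 1)].
have -> : \sum_(1 <= k < n.+1) (q %| k ^ 2 + 1) = #|S|.
  rewrite big_geq_mkord -sum1_card big_mkcond [RHS]big_mkcond /=.
  by apply: eq_bigr => k _; rewrite inE; case: ltnP => //= _; case: (q %| _).
have [->|[a]] := set_0Vmem S; first by rewrite cards0.
rewrite inE => /andP[a_gt0 da].
have -> : q <= n ^ 2 + 1.
  by apply: leq_trans (dvdn_leq _ da) _; rewrite ?addn1 // ltnS leq_sqr -ltnS.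
pose g (k : 'I_n.+1) := if k == a %[mod q] then n + k else n - k.
have gE k : k \in S -> g k = n + a %[mod q].
  rewrite inE => /andP[k_gt0 dk]; rewrite /g; case: eqP => [e|ne].
    by rewrite -modnDmr e modnDmr.
  have lekn : k <= n by rewrite -ltnS.
  have : (q %| k + a).
    have [leka|/ltnW leak] := leqP k a.
      have := dvdn_sqrS_pm _ _ _ _ p_pr p_odd leka dk da.
      by rewrite -eqn_mod_dvd // eq_sym => /orP[/eqP//|]; rewrite addnC.
    have := dvdn_sqrS_pm _ _ _ _ p_pr p_odd leak da dk.
    by rewrite -eqn_mod_dvd // => /orP[/eqP//|].
  move=> /eqP d; have -> : n + a = (n - k) + (k + a) by rewrite addnA subnK.
  by rewrite -[RHS]modnDmr d addn0.
pose f k : 'I_(n.*2 %/ q).+1 := inord (g k %/ q).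
have f_inj : {in S &, injective f}.
  move=> k l kS lS /(congr1 val).
  have g_le (i : 'I_n.+1) : g i %/ q < (n.*2 %/ q).+1.
    by rewrite ltnS leq_div2r // /g; have := ltn_ord i; case: ifP; lia.
  rewrite /= !inordK // => e.
  have gg : g k = g l by rewrite (divn_eq (g k) q) (divn_eq (g l) q) e !gE.
  move: kS lS; rewrite !inE => /andP[k_gt0 _] /andP[l_gt0 _].
  apply: val_inj => /=; move: gg (ltn_ord k) (ltn_ord l); rewrite /g.
  by case: ifP => _; case: ifP => _; lia.
by rewrite -(card_in_imset f_inj) addn1 -[X in _ <= X]card_ord max_card.
Qed.

Lemma logn_prodS_odd (p n : nat) : 0 < n -> prime p -> odd p ->
  logn p (P n) <= logn p (n.*2)`! + trunc_log p (n ^ 2 + 1).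
Proof.
move=> n_gt0 p_pr p_odd; pose B := n ^ 2 + n.*2 + 2.
rewrite logn_prodS (@logn_fact_sum _ _ B) //; last by rewrite /B; lia.
rewrite (@trunc_log_sum _ _ B) ?prime_gt1 ?addn_gt0 ?orbT //; last by rewrite /B; lia.
rewrite -big_split /= big_nat_cond.
under eq_bigr => k /andP[/andP[k_gt0 lekn] _].
  rewrite (@logn_sum_dvd _ _ B) ?addn_gt0 ?orbT //; last first.
    by move: lekn; rewrite ltnS -leq_sqr /B; lia.
  over.
rewrite -big_nat_cond exchange_big_nat /=.
by apply: leq_sum => j _; apply: count_sqrS.
Qed.

Lemma sqrS_p3mod4 (p k : nat) : prime p -> p %% 4 = 3 -> ~~ (p %| k ^ 2 + 1).
Proof.
move=> p_pr p3; apply/negP => d.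
have cop : coprime k p.
  rewrite coprime_sym prime_coprime //; apply/negP => dk.
  have : p %| 1 by rewrite -(dvdn_addr 1 (_ : p %| k ^ 2)) ?dvdn_exp.
  by rewrite dvdn1 => /eqP p1; rewrite p1 in p_pr.
have := cyclic.Euler_exp_totient cop.
rewrite totient_prime //.
have -> : p.-1 = 2 * (p %/ 4).*2.+1 by rewrite {1}(divn_eq p 4) p3; lia.
rewrite expnM; set a := k ^ 2 in d * => e.
have a_gt0 : 0 < a.
  by rewrite expn_gt0; case: (k) cop => //; rewrite /coprime gcd0n => /eqP p1; rewrite p1 in p_pr.
clearbody a; have sq : a ^ 2 = 1 %[mod p].
  apply/eqP; rewrite eqn_mod_dvd ?expn_gt0 ?a_gt0 //.
  by rewrite -[X in _ - X](exp1n 2) subn_sqr dvdn_mull.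
have {}e : a = 1 %[mod p].
  by rewrite -e expnS -mul2n expnM -modnMmr -modnXm sq modnXm exp1n modnMmr muln1.
have : p %| 2.
  have -> : 2 = (a + 1) - (a - 1) by rewrite subnBA // -addnA addKn.
  by rewrite dvdn_sub // -eqn_mod_dvd // e.
by rewrite dvdn_prime2 // => /eqP p2; rewrite p2 in p3.
Qed.

Lemma logn2_prodS n : logn 2 (P n) <= uphalf n.
Proof.
elim: n => [|n IHn]; first by rewrite big_geq // logn1.
rewrite big_nat_recr //= lognM ?prodS_gt0 ?addn1 //.
suff : logn 2 (n.+1 ^ 2).+1 <= ~~ odd n by move: IHn; rewrite !uphalf_half /=; lia.
have [n_odd|n_even] /= := boolP (odd n).
  by rewrite lognE dvdn2 oddS oddX oddS n_odd.
rewrite leqNgt -pfactor_dvdn //.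
have -> : (n.+1 ^ 2).+1 = 4 * (n./2 ^ 2 + n./2) + 2.
  by rewrite -{1}(even_halfK n_even) -muln2; nia.
by rewrite dvdn_addr ?dvdn_mulr.
Qed.

Lemma bin_leq_exp2 n k : 'C(n.+1, k) <= 2 ^ n.
Proof.
elim: n k => [|n IHn] [|k]; rewrite ?bin0 ?expn_gt0 //.
  by rewrite binS !bin0n; case: k.
by rewrite binS expnS mul2n -addnn leq_add.
Qed.

Lemma prime_dvd_fact p n : prime p -> (p %| n`!) = (p <= n).
Proof.
move=> p_pr; apply/idP/idP => [|lepn]; last by rewrite dvdn_fact ?prime_gt0.
elim: n => [|n IHn]; first by rewrite fact0 dvdn1 => /eqP p1; rewrite p1 in p_pr.
by rewrite factS Euclid_dvdM // => /orP[/dvdn_leq -> //|/IHn/leqW].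
Qed.

Lemma logn_fact_large p n : n < p -> logn p n`! = 0.
Proof.
by move=> ltnp; rewrite lognE; case: ifP => // /and3P[p_pr _]; rewrite prime_dvd_fact // leqNgt ltnp.
Qed.

Lemma prod_primes_dvd (s : seq nat) m : all prime s -> uniq s ->
  (forall p, p \in s -> p %| m) -> \prod_(p <- s) p %| m.
Proof.
elim: s m => [|p s IHs] m /=; first by rewrite big_nil dvd1n.
move=> /andP[p_pr s_pr] /andP[ps s_uniq] dvds; rewrite big_cons Gauss_dvd.
  by rewrite dvds ?mem_head // IHs // => q qs; rewrite dvds // inE qs orbT.
rewrite prime_coprime // Euclid_dvd_prod // big_has; apply: contra ps => /hasP[q qs].
by rewrite /= dvdn_prime2 ?(allP s_pr q qs) // => /eqP->.
Qed.

Lemma prod_primes_bin m :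
  \prod_(m.+2 <= p < m.*2.+2 | prime p) p <= 4 ^ m.
Proof.
apply: (@leq_trans 'C(m.*2.+1, m)); last first.
  by rewrite (leq_trans (bin_leq_exp2 _ _)) // -mul2n expnM.
rewrite dvdn_leq ?bin_gt0 //; first by lia.
rewrite -big_filter; apply: prod_primes_dvd; first exact: filter_all.
  by rewrite filter_uniq // iota_uniq.
move=> p; rewrite mem_filter mem_index_iota => /and3P[p_pr ltmp ltpm].
have le : m <= m.*2.+1 by lia.
have := prime_dvd_fact p (m.*2.+1) p_pr.
rewrite -(bin_fact le) !Euclid_dvdM // !prime_dvd_fact //.
have -> : m.*2.+1 - m = m.+1 by lia.
by rewrite -[p <= m.*2.+1]ltnS ltpm [p <= m.+1]leqNgt ltmp [p <= m]leqNgt (ltnW ltmp) !orbF => ->.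
Qed.

Lemma primorial_leq n : \prod_(0 <= p < n.+1 | prime p) p <= 4 ^ n.
Proof.
elim/ltn_ind: n => n IHn.
have [n_le2|n_gt2] := leqP n 2.
  by case: n n_le2 {IHn} => [|[|[|]]] // _; rewrite unlock.
have [n_odd|n_even] := boolP (odd n); last first.
  case: n n_gt2 n_even IHn => // n n_gt2 n_even IHn.
  rewrite big_mkcond big_nat_recr //= ifN ?muln1 -?big_mkcond; last first.
    by apply: contra n_even => n_pr; case: (even_prime n_pr) n_gt2 => // ->.
  by apply: leq_trans (IHn n _) _; rewrite // leq_exp2l.
pose m := n./2; have nE : n = m.*2.+1 by rewrite -[LHS]odd_double_half n_odd.
rewrite nE (@big_cat_nat _ _ _ m.+2) //=; last by lia.
apply: leq_trans (leq_mul (IHn m.+1 _) (prod_primes_bin m)) _; first by lia.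
by rewrite -expnD leq_exp2l //; lia.
Qed.

Lemma partn_prod_primes (pi : nat_pred) m b : 0 < m ->
  (forall p, prime p -> b < p -> logn p m = 0) ->
  m`_pi = \prod_(0 <= p < b.+1 | prime p && (p \in pi)) p ^ logn p m.
Proof.
move=> m_gt0 big_p; rewrite (@widen_partn (m + b)) ?leq_addr //.
rewrite (@big_cat_nat _ _ _ b.+1) //= ?ltnS ?leq_addl //.
rewrite [X in _ * X]big_nat_cond [X in _ * X]big1 ?muln1; last first.
  move=> p /andP[/andP[ltbp _] _]; have [p_pr|np] := boolP (prime p).
    by rewrite big_p.
  by rewrite lognE (negPf np).
rewrite big_mkcond [RHS]big_mkcond; apply: eq_bigr => p _.
by have [//|np] := boolP (prime p); rewrite lognE (negPf np) if_same.
Qed.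

Lemma trunc_log_leq p m k : 1 < p -> 0 < m -> m < p ^ k.+1 -> trunc_log p m <= k.
Proof.
move=> p_gt1 m_gt0 ltm; rewrite -ltnS -(ltn_exp2l _ _ p_gt1).
by apply: leq_ltn_trans ltm; apply: trunc_logP.
Qed.

Lemma prod_const_leq (Q : pred nat) c s b : 0 < c ->
  \prod_(0 <= p < b | Q p) (if p < s then c else 1) <= c ^ s.
Proof.
move=> c_gt0; apply: (@leq_trans (c ^ minn b s)); last by rewrite leq_pexp2l ?geq_minr.
elim: b => [|b IHb]; first by rewrite big_geq // min0n.
rewrite big_mkcond big_nat_recr //= -big_mkcond.
have [ltbs|lesb] := ltnP b s.
  rewrite (minn_idPl ltbs) (minn_idPl (ltnW ltbs)) in IHb *.
  by rewrite expnSr leq_mul //; case: ifP.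
rewrite if_same muln1 (minn_idPr (leqW lesb)).
by rewrite (minn_idPr lesb) in IHb.
Qed.

Lemma fact_sqr_leq_prodS n : n`! ^ 2 <= P n.
Proof.
elim: n => [|n IHn]; first by rewrite big_geq.
by rewrite big_nat_recr //= factS expnMn mulnC leq_mul // leq_addr.
Qed.

Lemma fact_double_leq n : (n.*2)`! <= 4 ^ n * n`! ^ 2.
Proof.
case: n => [|n] //.
have le : n.+1 <= n.+1.*2 by rewrite -addnn leq_addr.
rewrite -(bin_fact le) (_ : n.+1.*2 - n.+1 = n.+1) -?mulnn ?leq_mul //; last by lia.
rewrite doubleS (leq_trans (bin_leq_exp2 _ _)) //.
by rewrite -(expnM 2 2) leq_exp2l // mul2n.
Qed.

(* Such a prime could divide [P n] at most once. *)
Lemma logn_square_large n m p : 0 < n -> P n = m ^ 2 ->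
  prime p -> n.*2 < p -> logn p (P n) = 0.
Proof.
move=> n_gt0 Pm p_pr ltnp; have p_gt1 := prime_gt1 p_pr.
have p_odd : odd p by case: (even_prime p_pr) => // p2; move: ltnp; rewrite p2; lia.
have : logn p (P n) <= 1.
  apply: leq_trans (logn_prodS_odd _ _ n_gt0 p_pr p_odd) _.
  rewrite logn_fact_large // trunc_log_leq // ?addn1 //.
  have : (n.*2.+1) ^ 2 <= p ^ 2 by rewrite leq_sqr.
  by nia.
by rewrite Pm lognX; case: (logn p m) => // k; rewrite mulnS.
Qed.

Definition pi1mod4 : nat_pred := [pred p | p %% 4 == 1].

(* The last two factors of the bound are [p^2] if [p <= n] and [p] otherwise:
   [log_p(n^2+1) < 3] unless [p < s], and [log_p(n^2+1) < 2] if [p > n]. *)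
Lemma pfactor_prodS_leq n s p : 0 < n -> prime p -> n ^ 2 + 1 < s ^ 3 ->
  p ^ logn p (P n) <=
    (if p == 2 then 2 ^ uphalf n else 1)
    * ((if p \in pi1mod4 then p ^ logn p (n.*2)`! else 1)
    * ((if p < s then n ^ 2 + 1 else 1) * ((if p < n.+1 then p else 1) * p))).
Proof.
move=> n_gt0 p_pr lts.
have p_gt0 := prime_gt0 p_pr.
have [->|p_neq2] := eqVneq p 2.
  rewrite -[X in X <= _]muln1 leq_mul //; first by rewrite leq_exp2l // logn2_prodS.
  by rewrite !muln_gt0 /=; do 2!case: ifP => //; rewrite addn1.
have p_odd : odd p by case: (even_prime p_pr) p_neq2 => // ->.
rewrite mul1n inE; have [p1|p_neq1] := eqVneq (p %% 4) 1; last first.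
  have -> : logn p (P n) = 0.
    rewrite logn_prodS big1 // => k _.
    rewrite lognE (negPf (sqrS_p3mod4 _ _ p_pr _)) ?andbF //.
    by move: p_odd p_neq1; lia.
  rewrite mul1n !muln_gt0 p_gt0 andbT.
  by do 2!case: ifP => //; rewrite addn1.
apply: (@leq_trans (p ^ (logn p (n.*2)`! + trunc_log p (n ^ 2 + 1)))).
  by rewrite leq_exp2l ?prime_gt1 // logn_prodS_odd.
rewrite expnD leq_mul2l; apply/orP; right.
have N_gt0 : 0 < n ^ 2 + 1 by rewrite addn1.
have p_gt1 := prime_gt1 p_pr.
have [ltps|lesp] := ltnP p s.
  rewrite -[X in X <= _]muln1 leq_mul ?trunc_logP //.
  by rewrite muln_gt0 p_gt0 andbT; case: ifP.
rewrite mul1n; have [lepn|ltnp] := ltnP p n.+1.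
  rewrite mulnn leq_exp2l // trunc_log_leq //.
  by rewrite (leq_trans lts) // leq_exp2r.
rewrite mul1n -[X in _ <= X]expn1 leq_exp2l // trunc_log_leq //.
have : n.+1 ^ 2 <= p ^ 2 by rewrite leq_sqr.
by nia.
Qed.

Lemma prodS_leq n m s : 0 < n -> P n = m ^ 2 -> n ^ 2 + 1 < s ^ 3 ->
  P n <= 2 ^ uphalf n * ((n.*2)`!`_pi1mod4 * ((n ^ 2 + 1) ^ s * (4 ^ n * 4 ^ n.*2))).
Proof.
move=> n_gt0 Pm lts; rewrite -[X in X <= _]partnT ?prodS_gt0 //.
rewrite (@partn_prod_primes _ _ n.*2) ?prodS_gt0 //; last first.
  by move=> p; exact: logn_square_large n_gt0 Pm.
rewrite [X in _ <= _ * (X * _)](@partn_prod_primes _ _ n.*2) ?fact_gt0 //; last first.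
  by move=> p _; apply: logn_fact_large.
rewrite (eq_bigl prime) => [|p]; last by rewrite andbT.
apply: leq_trans; first by apply: leq_prod => p p_pr; apply: pfactor_prodS_leq n_gt0 p_pr lts.
rewrite !big_split /= leq_mul //.
  rewrite big_mkcond (bigD1_seq 2) ?iota_uniq ?mem_index_iota //=; last by lia.
  by rewrite big1 ?muln1 // => p /negPf->; rewrite if_same.
rewrite leq_mul //; first by rewrite -big_mkcondr.
rewrite leq_mul //; first by rewrite prod_const_leq ?addn1.
rewrite leq_mul ?primorial_leq // -big_mkcondr -big_nat_widen ?primorial_leq //.
by lia.
Qed.

Lemma part_fact_leq n m s : 0 < n -> P n = m ^ 2 -> n ^ 2 + 1 < s ^ 3 ->
  (n.*2)`!`_pi1mod4^' <= 2 ^ (8 * n + uphalf n) * (n ^ 2 + 1) ^ s.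
Proof.
move=> n_gt0 Pm lts; rewrite -(leq_pmul2l (part_gt0 pi1mod4 (n.*2)`!)).
rewrite partnC ?fact_gt0 //; apply: leq_trans (fact_double_leq n) _.
apply: leq_trans (leq_mul (leqnn _) (leq_trans (fact_sqr_leq_prodS n) (prodS_leq _ _ _ n_gt0 Pm lts))) _.
rewrite expnD -!(expnM 2 2).
rewrite (_ : 8 * n = 2 * n + (2 * n + 2 * n.*2)) ?expnD; last by lia.
set a := 2 ^ _; set b := _`_ _; set c := _ ^ s; set d := 2 ^ (2 * n.*2); set e := 2 ^ uphalf n.
by rewrite leq_eqVlt; apply/orP; left; apply/eqP; lia.
Qed.

Definition legendre (f M p : nat) := sumn (traject (divn^~ p) (M %/ p) f).

Lemma legendre_leq f M p : prime p -> f <= M -> legendre f M p <= logn p M`!.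
Proof.
move=> p_pr lefM; rewrite logn_fact // (@big_cat_nat _ _ _ f.+1) //= ?ltnS //.
apply: leq_trans (leq_addr _ _).
suff {lefM} E m : sumn (traject (divn^~ p) (m %/ p) f) = \sum_(1 <= k < f.+1) m %/ p ^ k.
  by rewrite -E.
elim: f m => [|f IHf] m; first by rewrite big_geq.
rewrite /= IHf [RHS]big_nat_recl //; congr (_ + _).
by apply: eq_bigr => k _; rewrite expnS divnMA.
Qed.

(* A lower bound for twice the binary logarithm of the part of [M!] made of the
   primes that are not 1 modulo 4; squaring [p] halves the rounding loss. *)
Definition log2_part_fact (f M : nat) :=
  sumn [seq legendre f M p * trunc_log 2 (p ^ 2)
       | p <- iota 0 M.+1 & prime p && (p %% 4 != 1)].

Lemma exp2_log2_part_fact f M : f <= M ->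
  2 ^ log2_part_fact f M <= (M`!`_pi1mod4^') ^ 2.
Proof.
move=> lefM; rewrite (@partn_prod_primes _ _ M) ?fact_gt0 //; last first.
  by move=> p _; apply: logn_fact_large.
rewrite /log2_part_fact -big_filter /index_iota subn0.
rewrite (eq_filter (_ : _ =1 (fun p => prime p && (p %% 4 != 1)))); last by [].
have: all prime [seq p <- iota 0 M.+1 | prime p && (p %% 4 != 1)].
  by apply/allP => p; rewrite mem_filter => /andP[/andP[]].
elim: [seq p <- _ | _] => [|p s IHs] /=; first by rewrite big_nil.
move=> /andP[p_pr /IHs le]; rewrite big_cons expnD expnMn leq_mul //.
rewrite mulnC expnM; apply: (@leq_trans ((p ^ 2) ^ legendre f M p)).
  by case: (legendre f M p) => // l; rewrite leq_exp2r // trunc_logP // expn_gt0 prime_gt0.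
by rewrite -expnM mulnC expnM leq_exp2r // leq_exp2l ?prime_gt1 // legendre_leq.
Qed.

Lemma fact_exp_dvd M q n : q * M <= n -> M`! ^ q %| n`!.
Proof.
elim: q n => [|q IHq] n; first by rewrite dvd1n.
rewrite mulSn => le; have leM : M <= n by apply: leq_trans le; rewrite leq_addr.
rewrite -(bin_fact leM) expnS dvdn_mull // dvdn_mul // IHq //.
by rewrite leq_subRL.
Qed.

Lemma prime_sqrS_not_square k n m : prime (k ^ 2 + 1) -> 0 < k <= n ->
  n + k < k ^ 2 + 1 -> P n <> m ^ 2.
Proof.
set p := k ^ 2 + 1 => p_pr /andP[k_gt0 lekn] ltnp Pm.
have : logn p (P n) = 1.
  rewrite logn_prodS (bigD1_seq k) ?iota_uniq ?mem_index_iota ?k_gt0 ?ltnS //=.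
  rewrite -/p (logn_prime _ p_pr) eqxx big_nat_cond big1 //.
  move=> l /andP[/andP[l_gt0]]; rewrite ltnS => leln neqlk.
  rewrite lognE [p %| _](negPf (_ : ~~ _)) ?andbF //; apply/negP => d.
  have dk : p %| k ^ 2 + 1 by [].
  have ndvd x : 0 < x -> x < p -> ~~ (p %| x).
    by move=> x_gt0 ltxp; rewrite gtnNdvd.
  have p_odd : odd p.
    case: (even_prime p_pr) => // p2; move: ltnp; rewrite p2; lia.
  have [lekl|/ltnW lelk] := leqP k l.
    have := dvdn_sqrS_pm _ 1 _ _ p_pr p_odd lekl dk d.
    by rewrite (negPf (ndvd (l - k) _ _)) ?(negPf (ndvd (l + k) _ _)) //; lia.
  have := dvdn_sqrS_pm _ 1 _ _ p_pr p_odd lelk d dk.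
  by rewrite (negPf (ndvd (k - l) _ _)) ?(negPf (ndvd (k + l) _ _)) //; lia.
by rewrite Pm lognX; case: (logn p m) => // j; rewrite mulnS.
Qed.

Lemma exp6_leq_exp2 x : 30 <= x -> x ^ 6 <= 2 ^ x.
Proof.
elim: x => // x IHx; rewrite leq_eqVlt => /orP[/eqP<-|].
  by rewrite (expnM 30 2 3) (expnM 2 10 3) leq_exp2r.
rewrite ltnS => x_ge; rewrite [X in _ <= X]expnS; apply: leq_trans (leq_mul (leqnn 2) (IHx x_ge)).
have : x.+1 ^ 3 * 10 <= x ^ 3 * 12 by nia.
rewrite !(expnM _ 3 2); nia.
Qed.

Lemma part_fact_leq_exp2 n m x : 0 < n -> P n = m ^ 2 -> 30 <= x -> n < x ^ 3 ->
  (n.*2)`!`_pi1mod4^' <= 2 ^ (8 * n + uphalf n + x ^ 3).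
Proof.
move=> n_gt0 Pm x_ge ltnx.
have le1 : n.+1 ^ 2 <= (x ^ 3) ^ 2 by rewrite leq_sqr.
have lts : n ^ 2 + 1 < (x ^ 2) ^ 3 by rewrite -expnM (expnM x 3 2); nia.
apply: leq_trans (part_fact_leq _ _ _ n_gt0 Pm lts) _.
rewrite [X in _ <= X]expnD leq_mul //.
apply: (@leq_trans ((x ^ 6) ^ (x ^ 2))).
  by rewrite leq_exp2r ?expn_gt0 ?(leq_trans _ x_ge) //; move: lts; rewrite -expnM; lia.
rewrite expnS [X in _ <= X]expnM leq_exp2r ?expn_gt0 ?(leq_trans _ x_ge) //.
exact: exp6_leq_exp2.
Qed.

Lemma log2_part_fact_square n m x f M : 0 < n -> P n = m ^ 2 -> 30 <= x ->
  n < x ^ 3 -> f <= M -> 0 < n.*2 %/ M ->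
  log2_part_fact f M * (n.*2 %/ M) <= (8 * n + uphalf n + x ^ 3) * 2.
Proof.
move=> n_gt0 Pm x_ge ltnx lefM q_gt0.
rewrite -(leq_exp2l _ _ (ltnSn 1)) expnM [X in _ <= X]expnM.
apply: (@leq_trans ((M`!`_pi1mod4^' ^ 2) ^ (n.*2 %/ M))).
  by rewrite leq_exp2r ?exp2_log2_part_fact.
rewrite expnAC leq_exp2r // -partnX.
apply: leq_trans (part_fact_leq_exp2 _ _ _ n_gt0 Pm x_ge ltnx).
by rewrite dvdn_leq ?part_gt0 // partn_dvd ?fact_gt0 // fact_exp_dvd // leq_trunc_div.
Qed.

Lemma prodS_not_square_large n m : 54 ^ 3 <= n -> P n <> m ^ 2.
Proof.
move=> n_ge Pm; have n_gt0 : 0 < n by apply: leq_trans n_ge.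
have ex : exists x, n < x ^ 3 by exists n.+1; nia.
have [x ltnx x_min] : {x | n < x ^ 3 & x.-1 ^ 3 <= n}.
  case: (ex_minnP ex) => x ltnx x_min; exists x => //.
  rewrite leqNgt; apply/negP => /x_min; case: x {x_min} ltnx => [|x _]; last by rewrite ltnn.
  by rewrite exp0n.
have lt54x : 54 < x.
  rewrite ltnNge; apply/negP => x_le.
  have : x ^ 3 <= 54 ^ 3 by rewrite leq_exp2r.
  by move: ltnx n_ge; clear; lia.
have le30x : 30 <= x by apply: leq_trans lt54x.
have x_small : 9 * x ^ 3 <= 10 * n.
  suff : 9 * x ^ 3 <= 10 * x.-1 ^ 3 by move: x_min; clear; lia.
  by case: x lt54x {ltnx x_min le30x} => // x /=; clear; nia.
have c_ge : 10 * 1002 <= log2_part_fact 10 1000 by vm_compute.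
have [lt_nq q_gt0] : n.*2 < (n.*2 %/ 1000) * 1000 + 1000 /\ 0 < n.*2 %/ 1000.
  by move: n_ge; clear; lia.
have := log2_part_fact_square _ _ _ 10 1000 n_gt0 Pm le30x ltnx isT q_gt0.
move/(leq_trans (leq_mul c_ge (leqnn _))); rewrite uphalf_half.
by move: x_small lt_nq n_ge; clear; lia.
Qed.

Theorem theorem2 (n : nat) (hn : 3 < n) :
  ~ exists m : nat, \prod_(1 <= k < n.+1) (k ^ 2 + 1) = m ^ 2.
Proof.
case=> m; have [|ltn] := leqP (54 ^ 3) n; first exact: prodS_not_square_large.
have [n_lt10|n_ge10] := ltnP n 10.
  by apply: (prime_sqrS_not_square 4) => //; move: hn n_lt10; clear; lia.
have [n_lt90|n_ge90] := ltnP n 90.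
  by apply: (prime_sqrS_not_square 10) => //; move: n_lt90; clear; lia.
have [n_lt400|n_ge400] := ltnP n 400.
  apply: (prime_sqrS_not_square 90); first by vm_compute.
    by rewrite n_ge90.
  by move: n_lt400; clear; lia.
apply: (prime_sqrS_not_square 400); first by vm_compute.
  by rewrite n_ge400.
by move: ltn; clear; lia.
Qed.
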